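(* Let $f:\mathrm{SL}(2,\mathbb{C})\times \mathrm{SL}(2,\mathbb{C})\to\mathbb{C}$ be a regular function which is invariant under the diagonal action of $\mathrm{SL}(2,\mathbb{C})$ by conjugation. Then there exists a polynomial $F(x,y,z)\in\mathbb{C}[x,y,z]$ such that $$f(\xi,\eta)=F(\mathrm{tr}(\xi),\mathrm{tr}(\eta),\mathrm{tr}(\xi\eta))\quad\text{for all }\xi,\eta\in\mathrm{SL}(2,\mathbb{C}).$$ Furthermore, for all $(x,y,z)\in\mathbb{C}^3$, there exists $(\xi,\eta)\in\mathrm{SL}(2,\mathbb{C})\times\mathrm{SL}(2,\mathbb{C})$ such that $$(x,y,z)=(\mathrm{tr}(\xi),\mathrm{tr}(\eta),\mathrm{tr}(\xi\eta)).$$ Conversely, if $x^2+y^2+z^2-xyz\neq 4$ and $(\xi,\eta),(\xi',\eta')\in\mathrm{SL}(2,\mathbb{C})\times\mathrm{SL}(2,\mathbb{C})$ satisfy $$(\mathrm{tr}(\xi),\mathrm{tr}(\eta),\mathrm{tr}(\xi\eta))=(\mathrm{tr}(\xi'),\mathrm{tr}(\eta'),\mathrm{tr}(\xi'\eta'))=(x,y,z),$$ then $(\xi',\eta')=g\cdot(\xi,\eta)$ for some $g\in\mathrm{SL}(2,\mathbb{C})$.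
   Context: $\mathrm{SL}(2,\mathbb{C})$ acts diagonally by conjugation: $g\cdot(\xi,\eta)=(g\xi g^{-1},g\eta g^{-1})$. A regular function on $\mathrm{SL}(2,\mathbb{C})\times\mathrm{SL}(2,\mathbb{C})$ is the restriction of a polynomial in the entries of the two matrices. *)

(* Defs.v *)
From HB Require Import structures.
From mathcomp Require Import all_boot all_order all_algebra.
From mathcomp Require Import reals complex mpoly.
Set Implicit Arguments.
Unset Strict Implicit.
Unset Printing Implicit Defensive.
Import GRing.Theory.
Local Open Scope ring_scope.

Record SL2 (K : fieldType) := MkSL2 {
  SL2val :> 'M[K]_2;
  SL2val_det : \det SL2val == 1
}.

HB.instance Definition _ (K : fieldType) := [isSub for @SL2val K].

Lemma SL2_conj_det (K : fieldType) (g xi : SL2 K) :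
  \det (g *m xi *m invmx g) == 1.
Proof.
by rewrite !det_mulmx det_inv (eqP (SL2val_det g)) (eqP (SL2val_det xi))
           invr1 !mulr1.
Qed.

Definition SL2_conj (K : fieldType) (g xi : SL2 K) : SL2 K :=
  MkSL2 (SL2_conj_det g xi).

Definition SL2_act (K : fieldType) (g : SL2 K) (p : SL2 K * SL2 K) :
    SL2 K * SL2 K :=
  (SL2_conj g p.1, SL2_conj g p.2).

(* The eight variables are the four entries of the first matrix, in row-major
   order, followed by the four entries of the second. *)
Definition SL2_regular (K : fieldType) (f : SL2 K * SL2 K -> K) : Prop :=
  exists P : {mpoly K[2 * 2 + 2 * 2]}, forall xi eta : SL2 K,
    f (xi, eta) = P.@[row_mx (mxvec xi) (mxvec eta) 0].

Definition SL2_invariant (K : fieldType) (f : SL2 K * SL2 K -> K) : Prop :=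
  forall (g : SL2 K) (p : SL2 K * SL2 K), f (SL2_act g p) = f p.

(* Main.v *)
Require Import Defs.
From Stdlib Require Import FunctionalExtensionality.
From mathcomp Require Import all_boot all_order all_algebra.
From mathcomp Require Import reals complex mpoly ring.
Set Implicit Arguments.
Unset Strict Implicit.
Unset Printing Implicit Defensive.
Import GRing.Theory.
Local Open Scope ring_scope.

(** Everything rests on one explicit slice.  For s t = 1 the pair

      [ x  -1 ]     [  0  t ]
      [ 1   0 ]  ,  [ -s  y ]

    in SL2 x SL2 has trace coordinates (x, y, s + t).  Over an algebraically
    closed field every z is of the form s + t with s t = 1, so all trace
    coordinates are attained.

    If x^2 + y^2 + z^2 - x y z != 4, then every pair with trace coordinates
    (x, y, z) is conjugate to the slice pair ([exists_conj_slice]): take an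
    eigenvector v of eta xi for the eigenvalue t and the basis (v, v xi^-1); in
    this basis the Cayley-Hamilton theorem puts xi and eta in the above form.
    The only obstruction is that v is an eigenvector of xi; then it is one of
    eta as well, and a common eigenvector forces x^2 + y^2 + z^2 - x y z = 4
    ([common_eigenvector_kappa]).  Two generic pairs with the same coordinates
    are thus conjugate to the same slice pair, hence to each other.

    For an invariant regular f, the restriction of f to the slice is a
    polynomial in x, y, s, t modulo s t = 1.  Since s is a root of
    S^2 - z S + 1, it has the form F(x, y, z) + s G(x, y, z)
    ([slice_regular]).  The slice pairs of (s, t) and (t, s) have the same
    coordinates, so they are conjugate when these are generic, and
    (s - t) G(x, y, z) = 0.  Hence f = F(traces) wherever x^2 + y^2 + z^2 -
    x y z != 4 and z^2 != 4 (the latter meaning s != t).  This nonempty open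
    set is dense, because the regular functions on SL2 x SL2 form an integral
    domain ([SL2_regular_integral]): any two points of SL2 are joined by a
    polynomial curve, and along a curve regular functions are polynomials in
    one variable. *)

(** * Two by two matrices *)

Definition mx2 (R : pzRingType) (a b c d : R) : 'M[R]_2 :=
  \matrix_(i, j) if i == 0 then (if j == 0 then a else b)
                 else (if j == 0 then c else d).

Lemma forall_I2 (P : 'I_2 -> Prop) : P 0 -> P 1 -> forall i, P i.
Proof.
move=> P0 P1 [[|[|//]] lti].
- by rewrite (_ : Ordinal lti = 0) //; apply: val_inj.
- by rewrite (_ : Ordinal lti = 1) //; apply: val_inj.
Qed.

Lemma mx2_eta (R : pzRingType) (A : 'M[R]_2) :
  A = mx2 (A 0 0) (A 0 1) (A 1 0) (A 1 1).
Proof.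
by apply/matrixP; apply: forall_I2; apply: forall_I2; rewrite !mxE.
Qed.

Lemma mul_mx2 (R : pzRingType) (a b c d a' b' c' d' : R) :
  mx2 a b c d *m mx2 a' b' c' d' =
  mx2 (a * a' + b * c') (a * b' + b * d') (c * a' + d * c') (c * b' + d * d').
Proof.
by apply/matrixP; apply: forall_I2; apply: forall_I2;
  rewrite !mxE !big_ord_recl big_ord0 !mxE /= addr0.
Qed.

Lemma mxtrace_mx2 (R : pzRingType) (a b c d : R) : \tr (mx2 a b c d) = a + d.
Proof. by rewrite /mxtrace !big_ord_recl big_ord0 !mxE /= addr0. Qed.

Lemma det_mx2 (R : comNzRingType) (a b c d : R) :
  \det (mx2 a b c d) = a * d - b * c.
Proof.
rewrite (expand_det_row _ 0) !big_ord_recl big_ord0 /cofactor !det_mx11 !mxE /=.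
by ring.
Qed.

Lemma det_sub_scalar_mx2 (R : comNzRingType) (A : 'M[R]_2) (t : R) :
  \det (A - t%:M) = \det A - t * \tr A + t ^+ 2.
Proof.
rewrite [A]mx2_eta [X in \det X]mx2_eta !det_mx2 mxtrace_mx2 !mxE /=.
by rewrite !mulr0n !mulr1n; ring.
Qed.

Lemma SL2_Cayley_Hamilton (K : fieldType) (A : SL2 K) :
  A *m A = \tr A *: (A : 'M[K]_2) - 1%:M.
Proof.
have := eqP (SL2val_det A); move: (SL2val A) => {}A.
rewrite [A]mx2_eta det_mx2 mul_mx2 mxtrace_mx2.
move: (A 0 0) (A 0 1) (A 1 0) (A 1 1) => a b c d det1.
by apply/matrixP; apply: forall_I2; apply: forall_I2;
  rewrite !mxE /= ?mulr0n ?mulr1n -?det1; ring.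
Qed.

(** * Conjugation in SL2 over an algebraically closed field *)

Lemma quadratic_root (K : closedFieldType) (a b : K) :
  exists s, s ^+ 2 = a * s + b.
Proof.
have [s] := solve_monicpoly (fun i => if i is 0 then b else a) (isT : (0 < 2)%N).
by rewrite !big_ord_recl big_ord0 /= => sE; exists s; rewrite sE; ring.
Qed.

Lemma sum_of_inverses (K : closedFieldType) (z : K) :
  exists s t, s * t == 1 /\ s + t = z.
Proof.
have [s sE] := quadratic_root z (-1).
by exists s, (z - s); split; [apply/eqP; ring: sE | ring].
Qed.

(** An intertwiner need only be invertible: dividing it by a square root of its
    determinant puts it in SL2. *)
Lemma SL2_act_of_intertwiner (K : closedFieldType) (p q : SL2 K * SL2 K)
    (h : 'M[K]_2) :
  \det h != 0 -> h *m p.1 = q.1 *m h -> h *m p.2 = q.2 *m h ->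
  exists g, SL2_act g p = q.
Proof.
case: p q => xi eta [xi' eta'] /= h0 hxi heta.
have [s] := quadratic_root 0 (\det h); rewrite mul0r add0r => s2.
have s0 : s != 0 by apply: contraNneq h0 => s0; rewrite -s2 s0 expr0n.
have g1 : \det (s^-1 *: h) == 1 by rewrite detZ -s2 exprVn mulVf ?expf_neq0.
have conjE (A B : SL2 K) : h *m A = B *m h -> SL2_conj (MkSL2 g1) A = B.
  move=> hA; apply: val_inj => /=.
  rewrite -scalemxAl hA scalemxAr -mulmxA mulmxV ?mulmx1 //.
  by rewrite unitmxE (eqP g1) unitr1.
by exists (MkSL2 g1); rewrite /SL2_act /= (conjE _ _ hxi) (conjE _ _ heta).
Qed.

Lemma SL2_act_same_image (K : closedFieldType) (g g' : SL2 K)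
    (p p' : SL2 K * SL2 K) :
  SL2_act g p = SL2_act g' p' -> exists k, SL2_act k p = p'.
Proof.
case: p p' => xi eta [xi' eta'] /(f_equal (fun q => (SL2val q.1, SL2val q.2))).
move=> /= [exi eeta].
have unitSL (A : SL2 K) : (A : 'M_2) \in unitmx.
  by rewrite unitmxE (eqP (SL2val_det A)) unitr1.
have move_inv (A B : 'M[K]_2) : g *m A *m invmx g = g' *m B *m invmx g' ->
    invmx g' *m g *m A = B *m (invmx g' *m g).
  move=> /(f_equal (fun M => invmx g' *m M *m g)).
  by rewrite !mulmxA mulmxKV // mulVmx // mul1mx.
apply: (SL2_act_of_intertwiner (h := invmx g' *m g)) => /=; [|exact: move_inv..].
by rewrite -unitfE -unitmxE unitmx_mul unitmx_inv !unitSL.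
Qed.

(** * The slice *)

Lemma det_slice_fst (K : fieldType) (x : K) : \det (mx2 x (-1) 1 0) == 1.
Proof. by rewrite det_mx2; apply/eqP; ring. Qed.

Lemma det_slice_snd (K : fieldType) (y s t : K) :
  s * t == 1 -> \det (mx2 0 t (- s) y) == 1.
Proof. by move=> /eqP st; rewrite det_mx2 -st; apply/eqP; ring. Qed.

Definition slice (K : fieldType) (x y s t : K) (st : s * t == 1) :
    SL2 K * SL2 K :=
  (MkSL2 (det_slice_fst x), MkSL2 (det_slice_snd y st)).

Lemma slice_traces (K : fieldType) (x y s t : K) (st : s * t == 1) :
  [/\ \tr (slice x y st).1 = x, \tr (slice x y st).2 = y
    & \tr ((slice x y st).1 *m (slice x y st).2) = s + t].
Proof. by split; rewrite /= ?mul_mx2 mxtrace_mx2; ring. Qed.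

(** On a common eigenvector, Cayley-Hamilton gives
    tr xi = a + 1/a, tr eta = b + 1/b, and s + t = a b + 1/(a b); these satisfy
    the relation identically, as for a pair of diagonal matrices. *)
Lemma common_eigenvector_kappa (K : fieldType) (xi eta : SL2 K)
    (v : 'rV[K]_2) (a b s t : K) :
  v != 0 -> v *m xi = a *: v -> v *m eta = b *: v -> t = a * b -> s * t = 1 ->
  (\tr xi) ^+ 2 + (\tr eta) ^+ 2 + (s + t) ^+ 2 - \tr xi * \tr eta * (s + t)
    = 4%:R.
Proof.
move=> v0 vxi veta -> {t} sab.
have eigen (A : SL2 K) c : v *m A = c *: v -> c * (\tr A - c) = 1.
  move=> vA; have : v *m A *m A = \tr A *: (v *m A) - v.
    by rewrite -mulmxA SL2_Cayley_Hamilton mulmxBr mulmx1 scalemxAr.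
  rewrite vA -scalemxAl vA !scalerA => /eqP.
  rewrite -subr_eq0 opprB addrA addrAC -scalerBl -[X in _ + X]scale1r -scalerDl.
  rewrite scaler_eq0 (negPf v0) orbF => /eqP e.
  by apply/eqP; rewrite -subr_eq0 -oppr_eq0 -e; apply/eqP; ring.
have /eigen ea := vxi; have /eigen eb := veta.
have unit_ne0 (c d : K) : c * d = 1 -> c != 0.
  by move=> /eqP; apply: contraTneq => ->; rewrite mul0r eq_sym oner_eq0.
have a0 := unit_ne0 _ _ ea; have b0 := unit_ne0 _ _ eb.
have -> : \tr xi = a + a^-1 by rewrite -[a^-1]mulr1 -ea mulKf // addrC subrK.
have -> : \tr eta = b + b^-1 by rewrite -[b^-1]mulr1 -eb mulKf // addrC subrK.
have -> : s = (a * b)^-1 by rewrite -[_^-1]mul1r -sab mulfK // mulf_neq0.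
by field; rewrite a0 b0.
Qed.

(** Matrices act on row vectors here, so the eigenvector is one of [eta *m xi],
    and the rows of the intertwiner [h] are the new basis v, u = v xi^-1. *)
Lemma exists_conj_slice (K : closedFieldType) (xi eta : SL2 K) (s t : K)
    (st : s * t == 1) :
  \tr (xi *m eta) = s + t ->
  (\tr xi) ^+ 2 + (\tr eta) ^+ 2 + (s + t) ^+ 2 - \tr xi * \tr eta * (s + t)
    <> 4%:R ->
  exists g, SL2_act g (xi, eta) = slice (\tr xi) (\tr eta) st.
Proof.
move=> trz kappa; have ts1 : t * s = 1 by rewrite mulrC (eqP st).
have s0 : s != 0 by apply: contraTneq st => ->; rewrite mul0r eq_sym oner_eq0.
have /det0P[v v0] : \det (eta *m xi - t%:M) == 0.
  rewrite det_sub_scalar_mx2 det_mulmx (eqP (SL2val_det eta)).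
  rewrite (eqP (SL2val_det xi)) mulr1 mxtrace_mulC trz -(eqP st); apply/eqP; ring.
rewrite mulmxBr mul_mx_scalar => /eqP; rewrite subr_eq0 mulmxA => /eqP vex.
(* [u] is v xi^-1, the inverse of [xi] being tr(xi) - xi. *)
pose u := \tr xi *: v - v *m xi.
have xi_inv (w : 'rV_2) : \tr xi *: (w *m xi) - w *m xi *m xi = w.
  rewrite -mulmxA SL2_Cayley_Hamilton mulmxBr mulmx1 -scalemxAr.
  by rewrite opprB addrC subrK.
have vxi : v *m xi = \tr xi *: v - u by rewrite opprB addrC subrK.
have uxi : u *m xi = v by rewrite mulmxBl -scalemxAl xi_inv.
have veta : v *m eta = t *: u.
  by rewrite -[LHS]xi_inv vex -scalemxAl scalerBr !scalerA mulrC.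
have uE : u = s *: (v *m eta) by rewrite veta scalerA (eqP st) scale1r.
have ueta : u *m eta = - s *: v + \tr eta *: u.
  rewrite [in LHS]uE -scalemxAl -mulmxA SL2_Cayley_Hamilton mulmxBr mulmx1.
  by rewrite -scalemxAr scalerBr scalerA mulrC -scalerA -uE addrC scaleNr.
pose h : 'M[K]_2 := \matrix_(i < 2) if i == 0 then v else u.
have hE (A : 'M[K]_2) a b c d : v *m A = a *: v + b *: u ->
    u *m A = c *: v + d *: u -> h *m A = mx2 a b c d *m h.
  move=> vA uA; apply/row_matrixP; apply: forall_I2; rewrite !row_mul !rowK /=.
    by rewrite vA mulmx_sum_row !big_ord_recl big_ord0 !rowK !mxE /= addr0.
  by rewrite uA mulmx_sum_row !big_ord_recl big_ord0 !rowK !mxE /= addr0.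
apply: (SL2_act_of_intertwiner (h := h)) => /=; last 2 first.
- by apply: hE; rewrite ?vxi ?uxi ?scaleN1r ?scale1r ?scale0r ?addr0.
- by apply: hE; rewrite ?veta ?ueta ?scale0r ?add0r.
(* A linear relation between v and u makes v a common eigenvector. *)
apply/negP => /det0P[w w0].
rewrite mulmx_sum_row !big_ord_recl big_ord0 !rowK /= addr0.
set w1 := w 0 0; set w2 := w 0 _ => wE.
have w20 : w2 != 0.
  apply: contraNneq w0 => w20; apply/eqP/rowP => j; move: j.
  move/eqP: wE; rewrite w20 scale0r addr0 scaler_eq0 (negPf v0) orbF => /eqP w10.
  apply: forall_I2; first by rewrite mxE.
  by rewrite [RHS]mxE; apply: etrans w20; congr (w 0 _); apply: val_inj.
pose a' := - w1 / w2.
have ua : u = a' *: v.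
  apply: (scalerI w20); rewrite scalerA mulrC divfK // scaleNr.
  by apply/eqP; rewrite -addr_eq0 addrC wE.
apply: kappa; apply: (common_eigenvector_kappa (v := v)
  (a := \tr xi - a') (b := t * a')) => //.
- by rewrite vxi ua scalerBl.
- by rewrite veta ua scalerA.
- have : (a' * (\tr xi - a')) *: v = v.
    by rewrite -scalerA scalerBl -ua -vxi scalemxAl -ua uxi.
  rewrite -[RHS]scale1r => /eqP.
  rewrite -subr_eq0 -scalerBl scaler_eq0 (negPf v0) orbF subr_eq0.
  by move=> /eqP e; rewrite mulrCA [_ * a']mulrC e mulr1.
- exact/eqP.
Qed.

(** * Regular functions *)

Lemma eq_fun_transport (T U : Type) (Q : (T -> U) -> Prop) (u w : T -> U) :
  Q u -> u =1 w -> Q w.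
Proof. by move=> Qu /functional_extensionality <-. Qed.

(** Polynomials in the functions [v i] are obtained from these and constants by
    sums and products, so any property stable under these operations passes to
    them. *)
Lemma meval_closed (T : Type) (K : comNzRingType) n (Q : (T -> K) -> Prop) :
  (forall c, Q (fun=> c)) ->
  (forall u w, Q u -> Q w -> Q (fun t => u t + w t)) ->
  (forall u w, Q u -> Q w -> Q (fun t => u t * w t)) ->
  forall (v : 'I_n -> T -> K) (P : {mpoly K[n]}),
    (forall i, Q (v i)) -> Q (fun t => P.@[v^~ t]).
Proof.
move=> QC QD QM v P Qv.
have Qsum I (r : seq I) (F : I -> T -> K) :
    (forall i, Q (F i)) -> Q (fun t => \sum_(i <- r) F i t).
  move=> QF; elim: r => [|i r IH].
    by apply: (eq_fun_transport (QC 0)) => t; rewrite big_nil.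
  by apply: (eq_fun_transport (QD _ _ (QF i) IH)) => t; rewrite big_cons.
have Qprod I (r : seq I) (F : I -> T -> K) :
    (forall i, Q (F i)) -> Q (fun t => \prod_(i <- r) F i t).
  move=> QF; elim: r => [|i r IH].
    by apply: (eq_fun_transport (QC 1)) => t; rewrite big_nil.
  by apply: (eq_fun_transport (QM _ _ (QF i) IH)) => t; rewrite big_cons.
have QX u k : Q u -> Q (fun t => u t ^+ k).
  move=> Qu; elim: k => [|k IH]; first exact: QC.
  by apply: (eq_fun_transport (QM _ _ Qu IH)) => t; rewrite exprS.
apply: eq_fun_transport (fun t => esym (mevalE _ _)).
by apply: Qsum => m; apply: QM => //; apply: Qprod => i; apply: QX.
Qed.

Lemma SL2_coordsP (K : fieldType) (Q : (SL2 K * SL2 K -> K) -> Prop) :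
  (forall i j, Q (fun p => p.1 i j)) -> (forall i j, Q (fun p => p.2 i j)) ->
  forall k, Q (fun p => row_mx (mxvec p.1) (mxvec p.2) 0 k).
Proof.
move=> Q1 Q2 k; case: (split_ordP k) => l ->; case/mxvec_indexP: l => i j.
  by apply: (eq_fun_transport (Q1 i j)) => p; rewrite row_mxEl mxvecE.
by apply: (eq_fun_transport (Q2 i j)) => p; rewrite row_mxEr mxvecE.
Qed.

Lemma SL2_regular_ind (K : fieldType) (Q : (SL2 K * SL2 K -> K) -> Prop) :
  (forall c, Q (fun=> c)) ->
  (forall u w, Q u -> Q w -> Q (fun p => u p + w p)) ->
  (forall u w, Q u -> Q w -> Q (fun p => u p * w p)) ->
  (forall i j, Q (fun p => p.1 i j)) -> (forall i j, Q (fun p => p.2 i j)) ->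
  forall f, SL2_regular f -> Q f.
Proof.
move=> QC QD QM Q1 Q2 f [P fP].
have -> : f = fun p => P.@[row_mx (mxvec p.1) (mxvec p.2) 0].
  by apply: functional_extensionality => -[xi eta]; apply: fP.
by apply: (meval_closed QC QD QM) => k; apply: (SL2_coordsP Q1 Q2).
Qed.

Section Regular.
Variable K : fieldType.
Implicit Types f h : SL2 K * SL2 K -> K.

Lemma SL2_regularC (c : K) : SL2_regular (fun=> c).
Proof. by exists c%:MP => xi eta; rewrite mevalC. Qed.

Lemma SL2_regularD f h :
  SL2_regular f -> SL2_regular h -> SL2_regular (fun p => f p + h p).
Proof.
by move=> [P fP] [Q hQ]; exists (P + Q) => xi eta; rewrite fP hQ mevalD.
Qed.

Lemma SL2_regularM f h :
  SL2_regular f -> SL2_regular h -> SL2_regular (fun p => f p * h p).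
Proof.
by move=> [P fP] [Q hQ]; exists (P * Q) => xi eta; rewrite fP hQ mevalM.
Qed.

Lemma SL2_regular_fst i j : SL2_regular (fun p : SL2 K * SL2 K => p.1 i j).
Proof.
exists 'X_(lshift _ (mxvec_index i j)) => xi eta.
by rewrite mevalXU row_mxEl mxvecE.
Qed.

Lemma SL2_regular_snd i j : SL2_regular (fun p : SL2 K * SL2 K => p.2 i j).
Proof.
exists 'X_(rshift _ (mxvec_index i j)) => xi eta.
by rewrite mevalXU row_mxEr mxvecE.
Qed.

Lemma SL2_regular_sum n (u : 'I_n -> SL2 K * SL2 K -> K) :
  (forall i, SL2_regular (u i)) -> SL2_regular (fun p => \sum_i u i p).
Proof.
elim: n u => [|n IH] u ur.
  by apply: (eq_fun_transport (SL2_regularC 0)) => p; rewrite big_ord0.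
have ur' := IH _ (fun i => ur (lift ord0 i)).
apply: (eq_fun_transport (SL2_regularD (ur ord0) ur')) => p.
by rewrite big_ord_recl.
Qed.

Lemma SL2_regular_traces (F : {mpoly K[3]}) :
  SL2_regular (fun p : SL2 K * SL2 K =>
    F.@[tnth [tuple \tr p.1; \tr p.2; \tr (p.1 *m p.2)]]).
Proof.
have R1 := SL2_regular_fst; have R2 := SL2_regular_snd.
pose v (i : 'I_3) (p : SL2 K * SL2 K) :=
  tnth [tuple \tr p.1; \tr p.2; \tr (p.1 *m p.2)] i.
apply: (meval_closed SL2_regularC SL2_regularD SL2_regularM (v := v)).
have Rprod : SL2_regular (fun p : SL2 K * SL2 K => \tr (p.1 *m p.2)).
  apply: SL2_regular_sum => i.
  apply: (eq_fun_transport (SL2_regular_sum (fun k => SL2_regularM (R1 i k) (R2 k i)))).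
  by move=> p; rewrite mxE.
rewrite /v => -[[|[|[|//]]] lti].
- by apply: (eq_fun_transport (SL2_regular_sum (fun i => R1 i i))).
- by apply: (eq_fun_transport (SL2_regular_sum (fun i => R2 i i))).
- exact: (eq_fun_transport Rprod).
Qed.

End Regular.

(** * Density of nonempty open sets *)

Definition poly_fun (K : nzRingType) (u : K -> K) :=
  exists q, forall t, u t = q.[t].

(** A product of four elementary matrices: a polynomial parametrization of SL2
    by affine 4-space, onto by [SL2_elem4]. *)
Definition elem4 (R : comNzRingType) (a b c d : R) : 'M[R]_2 :=
  mx2 1 a 0 1 *m mx2 1 0 b 1 *m mx2 1 c 0 1 *m mx2 1 0 d 1.

(** Three factors suffice when the lower left entry is nonzero, and one more
    column operation makes it so. *)
Lemma SL2_elem4 (K : fieldType) (g : SL2 K) :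
  exists a b c d, SL2val g = elem4 a b c d.
Proof.
have := eqP (SL2val_det g); move: (SL2val g) => A; rewrite [A]mx2_eta det_mx2.
move: (A 0 0) (A 0 1) (A 1 0) (A 1 1) => p q r s det1.
have [d rd] : exists d, r - d * s != 0.
  have [r0|r0] := eqVneq r 0; last by exists 0; rewrite mul0r subr0.
  exists 1; rewrite r0 sub0r mul1r oppr_eq0; apply/eqP => s0.
  by move/eqP: det1; rewrite r0 s0 !mulr0 subrr eq_sym oner_eq0.
set r' := r - d * s in rd; set p' := p - d * q.
have pE : p = p' + d * q by rewrite subrK.
have rE : r = r' + d * s by rewrite subrK.
have qE : q = (p' * s - 1) / r'.
  by apply: (canRL (mulfK rd)); rewrite -det1 /p' /r'; ring.
exists ((p' - 1) / r'), r', ((s - 1) / r'), d.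
by rewrite /elem4 !mul_mx2 pE rE qE; congr mx2; field.
Qed.

(** The curve is the image of a segment in the parameter space of [elem4]. *)
Lemma SL2_curve (K : fieldType) (g0 g1 : SL2 K) :
  exists c : K -> SL2 K,
    [/\ c 0 = g0, c 1 = g1 & forall i j, poly_fun (fun t => c t i j)].
Proof.
have [a0 [b0 [c0 [d0 g0E]]]] := SL2_elem4 g0.
have [a1 [b1 [c1 [d1 g1E]]]] := SL2_elem4 g1.
have det1 (a b c d : K) : \det (elem4 a b c d) == 1.
  by rewrite !det_mulmx !det_mx2; apply/eqP; ring.
pose l (a b t : K) := a + (b - a) * t.
exists (fun t => MkSL2 (det1 (l a0 a1 t) (l b0 b1 t) (l c0 c1 t) (l d0 d1 t))).
have l0 a b : l a b 0 = a by rewrite /l mulr0 addr0.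
have l1 a b : l a b 1 = b by rewrite /l mulr1 addrC subrK.
split; [by apply: val_inj; rewrite /= !l0|by apply: val_inj; rewrite /= !l1|].
pose L (a b : K) := a%:P + (b - a)%:P * 'X.
move=> i j; exists (elem4 (L a0 a1) (L b0 b1) (L c0 c1) (L d0 d1) i j) => t.
move: i j; apply: forall_I2; apply: forall_I2;
  rewrite /= /elem4 !mul_mx2 !mxE /=;
  rewrite !(hornerD, hornerM, hornerX, hornerC, horner0, hornerC 1) /l; ring.
Qed.

(** If [q] vanished everywhere without being 0, then [q - 1] would be a
    nonconstant polynomial without roots. *)
Lemma poly_eq0_closed (K : closedFieldType) (q : {poly K}) :
  (forall t, q.[t] = 0) -> q = 0.
Proof.
move=> q0; apply/eqP; apply/negPn/negP => qn0.
have [/size_poly1P[c c0 qE]|q1] := boolP (size q == 1).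
  by have /eqP := q0 0; rewrite qE hornerC (negPf c0).
have s1 : size (q - 1) = size q.
  rewrite size_polyDl // size_polyN size_poly1 ltn_neqAle eq_sym q1 /=.
  by rewrite lt0n size_poly_eq0.
have /closed_rootP[t] : size (q - 1) != 1 by rewrite s1.
by rewrite /root !hornerE q0 sub0r oppr_eq0 oner_eq0.
Qed.

(** Along a polynomial curve from [p] to [p1], [f] and [h] become polynomials
    with product 0; that of [h] is nonzero, so that of [f] is 0. *)
Lemma SL2_regular_integral (K : closedFieldType) (f h : SL2 K * SL2 K -> K) p1 :
  SL2_regular f -> SL2_regular h -> (forall p, f p * h p = 0) -> h p1 != 0 ->
  forall p, f p = 0.
Proof.
move=> fr hr fh hp1 p.
have [c [c0 c1 cP]] := SL2_curve p.1 p1.1.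
have [d [d0 d1 dP]] := SL2_curve p.2 p1.2.
have along u : SL2_regular u -> poly_fun (fun t => u (c t, d t)).
  move: u; apply: SL2_regular_ind => //.
  - by move=> a; exists a%:P => t; rewrite hornerC.
  - by move=> u w [q uq] [r wr]; exists (q + r) => t; rewrite uq wr hornerD.
  - by move=> u w [q uq] [r wr]; exists (q * r) => t; rewrite uq wr hornerM.
have [q fq] := along _ fr; have [r hr'] := along _ hr.
have /eqP : q * r = 0.
  by apply: poly_eq0_closed => t; rewrite hornerM -fq -hr' fh.
rewrite mulf_eq0 => /orP[]/eqP e.
  by have := fq 0; rewrite c0 d0 e horner0 -surjective_pairing.
have := hr' 1; rewrite c1 d1 e horner0 -surjective_pairing => /eqP.
by rewrite (negPf hp1).
Qed.

(** * Invariant functions *)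

(** K[x, y, s, t]/(s t - 1) is generated by 1 and s as a module over
    K[x, y, s + t], since s^2 = (s + t) s - 1. *)
Lemma slice_regular (K : fieldType) (f : SL2 K * SL2 K -> K) :
  SL2_regular f -> exists F G : {mpoly K[3]},
  forall x y s t (st : s * t == 1),
    f (slice x y st) = F.@[tnth [tuple x; y; s + t]]
                       + s * G.@[tnth [tuple x; y; s + t]].
Proof.
have X2 (x y z : K) : ('X_2 : {mpoly K[3]}).@[tnth [tuple x; y; z]] = z
  by rewrite mevalXU.
move: f; apply: SL2_regular_ind.
- by move=> c; exists c%:MP, 0 => x y s t st; rewrite mevalC meval0 mulr0 addr0.
- move=> u w [F [G uE]] [F' [G' wE]]; exists (F + F'), (G + G') => x y s t st.
  by rewrite uE wE !mevalD; ring.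
- move=> u w [F [G uE]] [F' [G' wE]].
  exists (F * F' - G * G'), (F * G' + F' * G + 'X_2 * (G * G')) => x y s t st.
  rewrite uE wE !(mevalD, mevalB, mevalM) X2.
  by ring: (eqP st).
- apply: forall_I2; apply: forall_I2.
  + by exists 'X_0, 0 => x y s t st; rewrite !mxE /= mevalXU meval0 mulr0 addr0.
  + by exists (-1)%:MP, 0 => x y s t st; rewrite !mxE /= mevalC meval0 mulr0 addr0.
  + by exists 1%:MP, 0 => x y s t st; rewrite !mxE /= mevalC meval0 mulr0 addr0.
  + by exists 0, 0 => x y s t st; rewrite !mxE /= meval0 mulr0 addr0.
- apply: forall_I2; apply: forall_I2.
  + by exists 0, 0 => x y s t st; rewrite !mxE /= meval0 mulr0 addr0.
  + exists 'X_2, (-1)%:MP => x y s t st; rewrite !mxE /= X2 mevalC; ring.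
  + exists 0, (-1)%:MP => x y s t st; rewrite !mxE /= mevalC meval0; ring.
  + by exists 'X_1, 0 => x y s t st; rewrite !mxE /= mevalXU meval0 mulr0 addr0.
Qed.

Lemma SL2_invariant_fun_of_traces (K : closedFieldType)
    (f : SL2 K * SL2 K -> K) :
  SL2_regular f -> SL2_invariant f ->
  exists F : {mpoly K[3]}, forall p,
    f p = F.@[tnth [tuple \tr p.1; \tr p.2; \tr (p.1 *m p.2)]].
Proof.
move=> fr finv; have [F [G fslice]] := slice_regular fr; exists F.
pose tr3 (p : SL2 K * SL2 K) :=
  tnth [tuple \tr p.1; \tr p.2; \tr (p.1 *m p.2)].
pose X i : {mpoly K[3]} := 'X_i.
(* [H] cuts out the pairs excluded by the slice argument: those that may have
   a common eigenvector, and those for which s = t. *)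
pose H := (X 0 ^+ 2 + X 1 ^+ 2 + X 2 ^+ 2 - X 0 * X 1 * X 2 - 4%:R%:MP)
          * (X 2 ^+ 2 - 4%:R%:MP).
have HE x y z : H.@[tnth [tuple x; y; z]] =
    (x ^+ 2 + y ^+ 2 + z ^+ 2 - x * y * z - 4%:R) * (z ^+ 2 - 4%:R).
  by rewrite /H !expr2 !(mevalD, mevalN, mevalM, mevalC, mevalXU).
(* A point where [H] does not vanish: x = y = 0 and any z with z^2 != 4; one of
   z = 0 and z = 1 works, whatever the characteristic. *)
have [z z4] : exists z : K, z ^+ 2 != 4%:R.
  have [e|] := eqVneq (0 ^+ 2 : K) 4%:R; last by exists 0.
  by exists 1; rewrite -e expr1n expr0n oner_neq0.
have [s1 [t1 [st1 z1]]] := sum_of_inverses z.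
pose d p := f p + (- 1) * F.@[tr3 p].
suff d0 p : d p = 0.
  by move=> p; apply/eqP; rewrite -subr_eq0 -mulN1r; apply/eqP/d0.
move: p; apply: (SL2_regular_integral (h := fun p => H.@[tr3 p])
  (p1 := slice 0 0 st1)).
- apply: SL2_regularD => //.
  by apply: SL2_regularM; [apply: SL2_regularC|apply: SL2_regular_traces].
- exact: SL2_regular_traces.
- case=> xi eta; have [->|] := eqVneq (H.@[tr3 (xi, eta)]) 0.
    by rewrite mulr0.
  rewrite HE mulf_eq0 negb_or !subr_eq0 => /andP[/eqP kappa z24].
  suff -> : d (xi, eta) = 0 by rewrite mul0r.
  have [s [t [st zE]]] := sum_of_inverses (\tr (xi *m eta)).
  have ts : t * s == 1 by rewrite mulrC.
  have stneq : s != t.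
    by apply: contraNneq z24 => e; rewrite -zE -(eqP st) e; apply/eqP; ring.
  have fE u w (uw : u * w == 1) : u + w = \tr (xi *m eta) ->
      f (xi, eta) = F.@[tr3 (xi, eta)] + u * G.@[tr3 (xi, eta)].
    move=> uwz; rewrite -uwz in kappa.
    have [g gE] := exists_conj_slice uw (esym uwz) kappa.
    by rewrite -(finv g) gE fslice /tr3 /= uwz.
  have fs := fE _ _ st zE; have ft := fE _ _ ts (etrans (addrC _ _) zE).
  have /eqP : (s - t) * G.@[tr3 (xi, eta)] = 0.
    apply/eqP; rewrite mulrBl subr_eq0.
    by apply/eqP/(addrI F.@[tr3 (xi, eta)]); rewrite -fs -ft.
  rewrite mulf_eq0 subr_eq0 (negPf stneq) /= => /eqP G0.
  by rewrite /d fs G0 mulr0 addr0 mulN1r subrr.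
- have [e1 e2 e3] := slice_traces 0 0 st1; rewrite /tr3 e1 e2 e3.
  rewrite HE z1 mulf_neq0 // ?subr_eq0 //.
  by rewrite !expr0n !mul0r subr0 !add0r.
Qed.

Theorem theoremA (R : realType) :
  (forall f : SL2 R[i] * SL2 R[i] -> R[i],
     SL2_regular f -> SL2_invariant f ->
     exists F : {mpoly R[i][3]}, forall xi eta : SL2 R[i],
       f (xi, eta) = F.@[tnth [tuple \tr xi; \tr eta; \tr (xi *m eta)]])
  /\
  (forall x y z : R[i], exists xi eta : SL2 R[i],
     (x, y, z) = (\tr xi, \tr eta, \tr (xi *m eta)))
  /\
  (forall (x y z : R[i]) (xi eta xi' eta' : SL2 R[i]),
     x ^+ 2 + y ^+ 2 + z ^+ 2 - x * y * z <> 4%:R ->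
     (\tr xi, \tr eta, \tr (xi *m eta)) = (x, y, z) ->
     (\tr xi', \tr eta', \tr (xi' *m eta')) = (x, y, z) ->
     exists g : SL2 R[i], (xi', eta') = SL2_act g (xi, eta)).
Proof.
split; [|split].
- move=> f fr finv; have [F fE] := SL2_invariant_fun_of_traces fr finv.
  by exists F => xi eta; rewrite fE.
- move=> x y z; have [s [t [st <-]]] := sum_of_inverses z.
  by exists (slice x y st).1, (slice x y st).2; have [-> -> ->] := slice_traces x y st.
- move=> x y z xi eta xi' eta' kappa [xE yE zE] [xE' yE' zE'].
  have [s [t [st stz]]] := sum_of_inverses z.
  have kappaE (A B : SL2 R[i]) : \tr A = x -> \tr B = y -> \tr (A *m B) = z ->
      exists g, SL2_act g (A, B) = slice x y st.
    move=> Ax By ABz; rewrite -Ax -By.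
    by apply: exists_conj_slice; rewrite stz // Ax By.
  have [g gE] := kappaE _ _ xE yE zE; have [g' g'E] := kappaE _ _ xE' yE' zE'.
  by have [k <-] := SL2_act_same_image (etrans gE (esym g'E)); exists k.
Qed.
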